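(* Let $I$ be a set of positive integers and let $\ell$ be a positive integer with $\ell\notin I$. Then there is no formula $\varphi\in\mathcal L_A(I)$ that is equivalent to $[A_\ell]p$ (for a propositional variable $p$).
   Context: Bimodal Kripke models $M=(W,R_1,R_2,\Pi)$, pointed models $(M,w)$. For a word $s=s_1\dots s_l\in\{1,2\}^*$, $w'$ is an $s$-successor of $w$ if there are $w=w_0,\dots,w_l=w'$ with $(w_{k-1},w_k)\in R_{s_k}$. A language $L\subseteq\{1,2\}^*$ yields the operator $[L]$: $M,w\models[L]\varphi$ iff $M,w'\models\varphi$ for every $s$-successor $w'$ of $w$ with $s\in L$. For $\ell\ge1$, $a^\ell_1$ and $a^\ell_2$ are the words of length $\ell$ over $\{1,2\}$ in which consecutive letters differ, starting with $1$ resp. $2$, and $A_\ell=\{a^\ell_1,a^\ell_2\}$. For a set $I$ of positive integers, $\mathcal L_A(I)$ is the logic with formulas $\varphi::=p\mid\neg\varphi\mid\varphi\vee\varphi\mid[A_k]\varphi$ ($k\in I$). Formulas are equivalent if they hold at the same pointed models. *)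

(* Defs.v *)
From Stdlib Require Import List Arith.
Import ListNotations.

Inductive letter : Set := one | two.

Definition other (a : letter) : letter :=
  match a with one => two | two => one end.

Definition word : Set := list letter.
Definition language : Type := word -> Prop.

(* [world] may be empty; a pointed model supplies the point separately. *)
Record model (V : Type) : Type := Model {
  world : Type;
  R1 : world -> world -> Prop;
  R2 : world -> world -> Prop;
  valuation : V -> world -> Prop
}.
Arguments world {V} _.
Arguments R1 {V} _ _ _.
Arguments R2 {V} _ _ _.
Arguments valuation {V} _ _ _.

Definition rel {V : Type} (M : model V) (a : letter) : world M -> world M -> Prop :=
  match a with one => R1 M | two => R2 M end.

Fixpoint successor {V : Type} (M : model V) (s : word) (w w' : world M) : Prop :=
  match s with
  | [] => w = w'
  | a :: s' => exists v : world M, rel M a w v /\ successor M s' v w'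
  end.

(* The ambient syntax has an operator [L] for every language L; the logics of
   interest are fragments of it. *)
Inductive formula (V : Type) : Type :=
| Var : V -> formula V
| Neg : formula V -> formula V
| Or : formula V -> formula V -> formula V
| Box : language -> formula V -> formula V.
Arguments Var {V} _.
Arguments Neg {V} _.
Arguments Or {V} _ _.
Arguments Box {V} _ _.

Fixpoint sat {V : Type} (M : model V) (w : world M) (phi : formula V) : Prop :=
  match phi with
  | Var p => valuation M p w
  | Neg psi => ~ sat M w psi
  | Or psi chi => sat M w psi \/ sat M w chi
  | Box L psi =>
      forall (s : word) (w' : world M), L s -> successor M s w w' -> sat M w' psi
  end.

Definition equivalent {V : Type} (phi psi : formula V) : Prop :=
  forall (M : model V) (w : world M), sat M w phi <-> sat M w psi.

Fixpoint alt (a : letter) (l : nat) : word :=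
  match l with
  | 0 => []
  | S l' => a :: alt (other a) l'
  end.

Definition A (l : nat) : language := fun s => s = alt one l \/ s = alt two l.

Inductive in_LA {V : Type} (I : nat -> Prop) : formula V -> Prop :=
| LA_Var : forall p : V, in_LA I (Var p)
| LA_Neg : forall phi : formula V, in_LA I phi -> in_LA I (Neg phi)
| LA_Or : forall phi psi : formula V,
    in_LA I phi -> in_LA I psi -> in_LA I (Or phi psi)
| LA_Box : forall (k : nat) (phi : formula V),
    I k -> in_LA I phi -> in_LA I (Box (A k) phi).

(* Main.v *)
(** One model separates [[A l] p] from the fragment.  Its worlds carry a level;
    every edge raises the level by one, up to [l], and variables only test
    whether the level is [l].  A plain world [(i, a, false)] starts an
    alternating path, beginning with [a], up to level [l].  A trunk world
    [(i, a, true)] continues an alternating trunk that stops just below level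
    [l]; for [i > 0] it may also leave the trunk, but only by repeating the
    letter through which it was entered, which breaks the alternation.  Hence
    every world reaches every higher level up to [l] by an alternating word,
    except that level [l] is out of reach from the root of the trunk.  For
    [k <> l], equality of levels is therefore a bisimulation for [A k], whereas
    [[A l] p] distinguishes [(0, one, true)] from [(0, one, false)]. *)

Require Import Defs.
From Stdlib Require Import List Arith Lia.

Definition trunk_world : Type := nat * letter * bool.

Definition level (x : trunk_world) : nat := fst (fst x).

Inductive trunk_step (l : nat) : letter -> trunk_world -> trunk_world -> Prop :=
| plain_step i a :
    i < l -> trunk_step l a (i, a, false) (S i, other a, false)
| stay_step i a :
    S i < l -> trunk_step l a (i, a, true) (S i, other a, true)
| leave_step i a :
    0 < i -> i < l -> trunk_step l (other a) (i, a, true) (S i, a, false).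

Definition trunk_model (V : Type) (l : nat) : model V :=
  Model V trunk_world (trunk_step l one) (trunk_step l two)
    (fun _ x => level x <> l).

Section TrunkModel.

Variables (V : Type) (l : nat).
Notation M := (trunk_model V l).

Lemma rel_trunk_model a (x y : world M) : rel M a x y = trunk_step l a x y.
Proof. now destruct a. Qed.

Lemma other_involutive a : other (other a) = a.
Proof. now destruct a. Qed.

Lemma alt_in_A a k : A k (alt a k).
Proof. destruct a; [left | right]; reflexivity. Qed.

Lemma length_alt a k : length (alt a k) = k.
Proof. revert a; induction k as [|k IH]; intro a; simpl; auto. Qed.

Lemma length_in_A k s : A k s -> length s = k.
Proof. intros [-> | ->]; apply length_alt. Qed.

Lemma trunk_step_level a x y :
  trunk_step l a x y -> level y = S (level x) /\ level y <= l.
Proof. destruct 1; unfold level; simpl; lia. Qed.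

Lemma successor_level s (x y : world M) :
  successor M s x y ->
  level y = level x + length s /\ (0 < length s -> level y <= l).
Proof.
  revert x; induction s as [|a s IH]; intros x H; simpl in *.
  - subst; lia.
  - destruct H as (v & Hv & H); rewrite rel_trunk_model in Hv.
    apply trunk_step_level in Hv; apply IH in H; lia.
Qed.

Lemma plain_successor k i a :
  i + k <= l -> exists y, successor M (alt a k) (i, a, false) y.
Proof.
  revert i a; induction k as [|k IH]; intros i a H; simpl.
  - eauto.
  - destruct (IH (S i) (other a)) as [y Hy]; [lia|].
    exists y, (S i, other a, false); split; [|exact Hy].
    rewrite rel_trunk_model; constructor; lia.
Qed.

Lemma trunk_successor k i a :
  i + k < l -> exists y, successor M (alt a k) (i, a, true) y.
Proof.
  revert i a; induction k as [|k IH]; intros i a H; simpl.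
  - eauto.
  - destruct (IH (S i) (other a)) as [y Hy]; [lia|].
    exists y, (S i, other a, true); split; [|exact Hy].
    rewrite rel_trunk_model; constructor; lia.
Qed.

(** At the root of the trunk, [k <> l] forces [k < l], so the trunk is long enough; higher trunk
    worlds leave the trunk with the first edge, and plain worlds follow their own path. *)
Lemma A_successor_exists k (x : world M) :
  0 < k -> k <> l -> level x + k <= l ->
  exists s y, A k s /\ successor M s x y.
Proof.
  destruct x as [[i a] []]; unfold level; simpl; intros Hk Hkl H.
  - destruct (Nat.eq_dec i 0) as [->|Hi].
    + destruct (trunk_successor k 0 a) as [y Hy]; [lia|].
      exists (alt a k), y; split; [apply alt_in_A | exact Hy].
    + destruct k as [|k]; [lia|].
      destruct (plain_successor k (S i) a) as [y Hy]; [lia|].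
      exists (alt (other a) (S k)), y; split; [apply alt_in_A|].
      exists (S i, a, false); rewrite rel_trunk_model, other_involutive.
      split; [constructor; lia | exact Hy].
  - destruct (plain_successor k i a H) as [y Hy].
    exists (alt a k), y; split; [apply alt_in_A | exact Hy].
Qed.

Lemma letter_neq_other a : a <> other a.
Proof. now destruct a. Qed.

(** An alternating word that begins with the letter stored in a trunk world stays on the trunk:
    leaving needs the opposite letter. *)
Lemma trunk_alt_successor_level k i a y :
  i < l -> successor M (alt a k) (i, a, true) y -> level y < l.
Proof.
  revert i a; induction k as [|k IH]; intros i a Hi H; simpl in H.
  - now subst.
  - destruct H as (v & Hv & H); rewrite rel_trunk_model in Hv.
    inversion Hv; subst.
    + now apply IH in H.
    + exfalso; eapply letter_neq_other; eauto.
Qed.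

Lemma trunk_root_first_letter k a b y :
  0 < k -> successor M (alt b k) (0, a, true) y -> b = a.
Proof.
  destruct k as [|k]; [lia|]; intros _ (v & Hv & _).
  rewrite rel_trunk_model in Hv; inversion Hv; subst; trivial; lia.
Qed.

Lemma trunk_root_no_A_successor a s y :
  0 < l -> A l s -> ~ successor M s (0, a, true) y.
Proof.
  intros Hl Hs H.
  destruct (successor_level _ _ _ H) as [Hy _].
  rewrite (length_in_A _ _ Hs) in Hy; unfold level in Hy at 2; simpl in Hy.
  assert (Hb : exists b, s = alt b l) by (destruct Hs; eauto).
  destruct Hb as [b ->].
  apply trunk_root_first_letter in H as Hab; [|exact Hl].
  subst b; apply trunk_alt_successor_level in H; lia.
Qed.

Lemma sat_level_invariant (I : nat -> Prop) phi :
  (forall k, I k -> 0 < k) -> ~ I l -> in_LA I phi ->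
  forall x y : world M, level x = level y -> sat M x phi -> sat M y phi.
Proof.
  intros Ipos Il; induction 1 as [q|phi _ IH|phi psi _ IH1 _ IH2|k phi Ik _ IH];
    simpl; intros x y Hxy Hx.
  - congruence.
  (* One direction is enough because equality of levels is symmetric. *)
  - intro Hy; apply Hx, (IH y x); auto.
  - destruct Hx; [left; apply (IH1 x) | right; apply (IH2 x)]; auto.
  - intros s y' Hs Hy'.
    destruct (successor_level _ _ _ Hy') as [E1 E2].
    rewrite (length_in_A _ _ Hs) in E1, E2.
    assert (Hk := Ipos k Ik).
    (* Since [0 < k], the level of [y'] is at most [l], so [x] has an [A k]-successor on that level
       too. *)
    destruct (A_successor_exists k x) as (t & x' & Ht & Hx').
    + exact Hk.
    + congruence.
    + lia.
    + apply (IH x'); [|now apply (Hx t)].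
      destruct (successor_level _ _ _ Hx') as [E3 _].
      rewrite (length_in_A _ _ Ht) in E3; lia.
Qed.

End TrunkModel.

Theorem theorem8 (V : Type) (I : nat -> Prop) (I_pos : forall k : nat, I k -> 0 < k)
    (l : nat) (l_pos : 0 < l) (l_notin : ~ I l) (p : V) :
  ~ exists phi : formula V, in_LA I phi /\ equivalent phi (Box (A l) (Var p)).
Proof.
  intros (phi & Hphi & Heq).
  assert (Htrunk : sat (trunk_model V l) (0, one, true) phi).
  (* The box holds vacuously here. *)
  { apply Heq; intros s y Hs Hy.
    now apply trunk_root_no_A_successor in Hy. }
  assert (Hplain : sat (trunk_model V l) (0, one, false) phi).
  { now apply (sat_level_invariant V l I phi I_pos l_notin Hphi (0, one, true)). }
  apply Heq in Hplain.
  destruct (plain_successor V l l 0 one) as [y Hy]; [lia|].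
  (* [y] lies on level [l], where [p] is false. *)
  apply (Hplain _ y (alt_in_A one l) Hy).
  destruct (successor_level _ _ _ _ _ Hy) as [E _].
  rewrite length_alt in E; exact E.
Qed.
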